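(* Let $f(x,y) = Cx^2 + Dy^2$ with $C, D \in \mathbb{Q}$ nonzero. Then there exist infinitely many rational periodic vectors of type $(L)$ for $f$.
   Context: For $f : \mathbb{Q}^2 \to \mathbb{Q}$ define $f_L : \mathbb{Q}^2 \to \mathbb{Q}^2$ by $f_L(x,y) = (f(x,y), y)$ (replacement of the left entry). A rational periodic vector of type $(L)$ for $f$ is a vector $\overline{v} \in \mathbb{Q}^2$ with $f_L(\overline{v}) = \overline{v}$. *)

(* Defs.v *)
From mathcomp Require Import all_boot all_order all_algebra.
From mathcomp Require Import boolp classical_sets cardinality.

Set Implicit Arguments.
Unset Strict Implicit.
Unset Printing Implicit Defensive.

Local Open Scope ring_scope.

Definition replace_left (f : rat * rat -> rat) (v : rat * rat) : rat * rat :=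
  (f v, v.2).

Definition rational_periodic_L (f : rat * rat -> rat) (v : rat * rat) : Prop :=
  replace_left f v = v.

Definition diag_quadratic (C D : rat) (v : rat * rat) : rat :=
  C * v.1 ^+ 2 + D * v.2 ^+ 2.

(* Main.v *)
Require Import Defs.
From mathcomp Require Import all_boot all_order all_algebra.
From mathcomp Require Import boolp classical_sets cardinality.
From mathcomp Require Import ring lra.

(** The equation [C x^2 + D y^2 = x] of the periodic vectors is a conic through
    the rational point [(0, 0)], so it is parametrized by the slope [t] of the
    lines through that point: the line [y = t x] meets the conic again where
    [x (C + D t^2) = 1] ([conic_point_periodic]).  The slope is recovered as
    [y / x], hence distinct slopes give distinct points ([conic_point_inj]).
    The only slopes to avoid are the rational roots of [C + D t^2], and these
    are bounded: every [t > 1 + |C / D|] is admissible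
    ([large_slope_admissible]), which leaves infinitely many of them. *)

Set Implicit Arguments.
Unset Strict Implicit.
Unset Printing Implicit Defensive.

Import Order.TTheory GRing.Theory Num.Theory.

Local Open Scope classical_set_scope.
Local Open Scope ring_scope.

Definition conic_point (C D t : rat) : rat * rat :=
  ((C + D * t ^+ 2)^-1, t / (C + D * t ^+ 2)).

Lemma conic_point_periodic (C D t : rat) : C + D * t ^+ 2 != 0 ->
  rational_periodic_L (diag_quadratic C D) (conic_point C D t).
Proof.
move=> nz; rewrite /rational_periodic_L /replace_left /diag_quadratic /=.
by congr pair; field.
Qed.

Lemma conic_point_inj (C D t u : rat) :
  C + D * t ^+ 2 != 0 -> C + D * u ^+ 2 != 0 ->
  conic_point C D t = conic_point C D u -> t = u.
Proof.
move=> nzt nzu [/invr_inj eq_den]; rewrite eq_den.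
by apply: mulIf; rewrite invr_eq0.
Qed.

(** A root would satisfy [t^2 = - C / D <= |C / D| < t], whereas
    [t <= t^2] as soon as [1 <= t]. *)
Lemma large_slope_admissible (C D t : rat) :
  D != 0 -> 1 + `|C / D| < t -> C + D * t ^+ 2 != 0.
Proof.
move=> D0 lt_t; apply/eqP => root_t.
have sqr_t : t ^+ 2 = - (C / D).
  by apply: (mulfI D0); rewrite mulrN [D * (C / D)]mulrC divfK //; lra.
have := ler_norm (- (C / D)); rewrite normrN -sqr_t => le_norm.
have norm_ge0 := normr_ge0 (C / D).
nra.
Qed.

Theorem proposition3p3 (C D : rat) (hC : C != 0) (hD : D != 0) :
  infinite_set
    [set v : rat * rat | rational_periodic_L (diag_quadratic C D) v].
Proof.
pose slope (n : nat) : rat := 2 + `|C / D| + n%:R.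
have slope_ok n : C + D * slope n ^+ 2 != 0.
  apply: large_slope_admissible => //; rewrite /slope.
  by have := ler0n rat n; lra.
have point_inj : injective (fun n => conic_point C D (slope n)).
  move=> m n /(conic_point_inj (slope_ok m) (slope_ok n)) /addrI /eqP.
  by rewrite eqr_nat => /eqP.
move=> /(finite_preimage (in2W point_inj)) fin_nat.
apply: infinite_nat; apply: sub_finite_set fin_nat => n _.
exact: conic_point_periodic.
Qed.
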